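(* Let $a=a_\pm=\frac14\pm\frac{\mathrm{i}}{4\sqrt3}$ (either sign). Then $A_a(q)$ is real for real $q$, with $$A_a(q)=1-\frac{q^2}{2}+\frac{q^4}{24}.$$ The nonzero modes satisfy $|A_a(q)|<1$ for $0<q^2<12$. Hence, with the fourth-order staggered spatial discretization in $d$ dimensions, the spectral CFL threshold is $$s_{\rm disp}^*=\frac{6\sqrt3}{7\sqrt d},$$ with robust time stepping requiring $s<s_{\rm disp}^*$.
   Context: Setting. For a nonzero transverse Fourier mode, the energy-scaled, spatially semidiscretized, constant-coefficient lossless Maxwell system (wave speed $\nu>0$) reduces to $\frac{d}{dt}(h,e)^{T}=\nu K_h\begin{bmatrix}0&-1\\1&0\end{bmatrix}(h,e)^{T}$. It is split into $C=\nu K_h\begin{bmatrix}0&0\\1&0\end{bmatrix}$ and $D=\nu K_h\begin{bmatrix}0&-1\\0&0\end{bmatrix}$. With time step $\Delta t>0$ and $q=\nu\Delta t K_h$, the one-step matrix of the five-subflow palindromic family with parameter $a\in\mathbb{C}$ is $$M_a(q)=e^{a\Delta t C}e^{\frac12\Delta t D}e^{(1-2a)\Delta t C}e^{\frac12\Delta t D}e^{a\Delta t C}.$$ It has determinant $1$ and both diagonal entries equal to a common value $A_a(q)$, given by $A_a(q)=1-\frac{q^2}{2}+\frac{g_2(a)}{2}q^4$ with $g_2(a)=a(1-2a)/2$; its characteristic polynomial is $\lambda^2-2A_a(q)\lambda+1$. When $A_a(q)$ is real, spectral (von Neumann) stability at $q$ means $|A_a(q)|\le1$. Fourth-order staggered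 stencil. In $d\ge 1$ spatial dimensions with equal mesh width $\Delta x$ in every active direction, each first derivative is replaced by $\frac{27(u_{i+1/2}-u_{i-1/2})-(u_{i+3/2}-u_{i-3/2})}{24\Delta x}$. For a wave vector $\kappa\in\mathbb{R}^d$, set $$\eta_\xi=\frac{27\sin(\kappa_\xi\Delta x/2)-\sin(3\kappa_\xi\Delta x/2)}{12}\in\left[-\tfrac73,\tfrac73\right],\qquad K_h^2=\frac1{\Delta x^2}\sum_{\xi=1}^d\eta_\xi^2,\qquad s=\frac{\nu\Delta t}{\Delta x},$$ so $q=\nu\Delta tK_h=s\,(\sum_\xi\eta_\xi^2)^{1/2}$ and $0\le q^2\le\frac{49d}{9}s^2$. The spectral CFL threshold of a coefficient $a$ is the supremum of the $s>0$ for which, for all $\kappa\in\mathbb{R}^d$, $q=q(\kappa)$ lies in the contiguous interval containing $0$ on which $|A_a|\le1$. By convention, ''robust time stepping'' uses the strict inequality requiring $s$ to be smaller than the threshold. *)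

(* Defs.v *)
From mathcomp Require Import all_boot all_order all_algebra.
From mathcomp Require Import all_classical all_reals all_analysis.
From mathcomp Require Import complex ring.

Set Implicit Arguments.
Unset Strict Implicit.
Unset Printing Implicit Defensive.

Import Order.TTheory GRing.Theory Num.Theory.
Import numFieldNormedType.Exports.

Local Open Scope classical_set_scope.
Local Open Scope ring_scope.
Local Open Scope complex_scope.

(* The limit is taken in the sup-norm topology of the matrix space; when the
   series diverges the value of [lim] is unspecified. *)
Definition expm (K : numFieldType) (n : nat) (A : 'M[K]_n.+1) : 'M[K]_n.+1 :=
  lim (series (fun k : nat => (k`!%:R)^-1 *: A ^+ k) @ \oo).

Section Splitting.
Variable R : realType.

(* Coordinates are ordered (h, e). *)
Definition splitC (nu Kh : R) : 'M[R[i]]_2 := (nu * Kh)%:C *: delta_mx 1 0.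
Definition splitD (nu Kh : R) : 'M[R[i]]_2 := (nu * Kh)%:C *: - delta_mx 0 1.

Definition one_step (a : R[i]) (nu dt Kh : R) : 'M[R[i]]_2 :=
  let C := splitC nu Kh in
  let D := splitD nu Kh in
  expm ((a * dt%:C) *: C) *
  expm ((2^-1 * dt%:C) *: D) *
  expm (((1 - 2 * a) * dt%:C) *: C) *
  expm ((2^-1 * dt%:C) *: D) *
  expm ((a * dt%:C) *: C).

(* The one-step matrix depends on nu, dt and K_h only through the product
   q = nu dt K_h (lemma one_stepE), so it is normalized to nu = dt = 1. *)
Definition Mstep (a : R[i]) (q : R) : 'M[R[i]]_2 := one_step a 1 1 q.

Lemma one_stepE a nu dt Kh : one_step a nu dt Kh = Mstep a (nu * dt * Kh).
Proof.
have E (c : R[i]) (X : 'M[R[i]]_2) :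
    (c * dt%:C) *: ((nu * Kh)%:C *: X) =
    (c * 1%:C) *: ((1 * (nu * dt * Kh))%:C *: X).
  by rewrite !scalerA -!mulrA -!rmorphM /= !mul1r mulrCA mulrA.
by rewrite /Mstep /one_step /splitC /splitD !E.
Qed.

Lemma expm_sqr0 (K : numFieldType) n (A : 'M[K]_n.+1) :
  A ^+ 2 = 0 -> expm A = 1 + A.
Proof.
move=> A0; apply: norm_lim_near_cst.
exists 2%N => // n' /= n'2; rewrite /series /=.
rewrite (big_cat_nat (n := 2)) //= big_nat_recr //= big_nat1.
rewrite !fact0 invr1 !scale1r expr0 expr1 big_nat big1 ?addr0 //.
by move=> k /andP[k2 _]; rewrite -(subnK k2) exprD A0 mulr0 scaler0.
Qed.

Lemma Mstep_diag a q : Mstep a q 1 1 = Mstep a q 0 0.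
Proof.
have C2 c d : (c *: (d *: delta_mx 1 0) : 'M[R[i]]_2) ^+ 2 = 0.
  by rewrite expr2 -!(scalerAl, scalerAr) -mulmxE mul_delta_mx_0 ?scaler0.
have D2 c d : (c *: (d *: - delta_mx 0 1) : 'M[R[i]]_2) ^+ 2 = 0.
  rewrite expr2 !scalerN mulrNN -!(scalerAl, scalerAr) -mulmxE.
  by rewrite mul_delta_mx_0 ?scaler0.
have pal (U V W : 'M[R[i]]_2) : U 0 0 = U 1 1 -> V 0 0 = V 1 1 ->
    W 0 0 = W 1 1 -> (U * V * W * V * U) 1 1 = (U * V * W * V * U) 0 0.
  have E2 (X Y : 'M[R[i]]_2) i j : (X * Y) i j = X i 0 * Y 0 j + X i 1 * Y 1 j.
    rewrite -mulmxE mxE big_ord_recl big_ord1.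
    by congr (_ + _ * _); congr fun_of_matrix; exact/val_inj.
  by rewrite !E2 => -> -> ->; ring.
rewrite /Mstep /one_step /splitC /splitD !expm_sqr0 //.
by apply: pal; rewrite !mxE /= ?mulr0 ?oppr0 ?mulr0.
Qed.

(* The common value of the two diagonal entries (lemma Mstep_diag). *)
Definition Astep (a : R[i]) (q : R) : R[i] := Mstep a q 0 0.

Definition a_plus : R[i] := 4^-1 +i* (4 * Num.sqrt 3)^-1.
Definition a_minus : R[i] := 4^-1 -i* (4 * Num.sqrt 3)^-1.

End Splitting.

Section Threshold.
Variable R : realType.

(* On x |-> exp(i k x) the staggered stencil acts as multiplication by
   i * eta dx k / dx. *)
Definition eta (dx k : R) : R :=
  (27 * sin (k * dx / 2) - sin (3 * k * dx / 2)) / 12.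

Definition Kh (d : nat) (dx : R) (kappa : 'rV[R]_d) : R :=
  Num.sqrt ((dx ^+ 2)^-1 * \sum_(xi < d) eta dx (kappa 0 xi) ^+ 2).

Definition qmode (d : nat) (nu dx dt : R) (kappa : 'rV[R]_d) : R :=
  nu * dt * Kh dx kappa.

Definition courant (nu dx dt : R) : R := nu * dt / dx.

(* `|Astep a q| is the complex modulus, itself an element of R[i]. *)
Definition stability_interval (a : R[i]) : set R :=
  connected_component [set q : R | `|Astep a q| <= 1] 0.

Definition spectrally_stable (a : R[i]) (d : nat) (nu dx dt : R) : Prop :=
  forall kappa : 'rV[R]_d, stability_interval a (qmode nu dx dt kappa).

Definition cfl_threshold (a : R[i]) (d : nat) (nu dx : R) : \bar R :=
  ereal_sup [set (courant nu dx dt)%:E | dt in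
    [set dt : R | 0 < dt /\ spectrally_stable a d nu dx dt]].

Definition robust_step (a : R[i]) (d : nat) (nu dx dt : R) : Prop :=
  ((courant nu dx dt)%:E < cfl_threshold a d nu dx)%E.

Definition s_disp (d : nat) : R := 6 * Num.sqrt 3 / (7 * Num.sqrt d%:R).

End Threshold.

(* Main.v *)
(** For [a = a_plus] or [a = a_minus] one has [a (1 - 2 a) = 1/6], so that with
    [x = q^2] the diagonal entry is [1 - x/2 + x^2/24].  It stays above [-1]
    because [x^2/24 - x/2 + 2] has negative discriminant, and is at most [1]
    exactly when [0 <= x <= 12]; hence [|A| <= 1] holds precisely on the
    interval [q^2 <= 12], which is connected.  The symbol is
    [eta = (24 t + 4 t^3) / 12] with [t] the sine of the half angle, so its
    largest modulus is [7/3], attained at the wave number [pi / dx] in every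
    direction simultaneously.  Stability thus amounts to
    [s^2 * 49 d / 9 <= 12]. *)

Require Import Defs.
From mathcomp Require Import all_boot all_order all_algebra.
From mathcomp Require Import all_classical all_reals all_analysis.
From mathcomp Require Import complex.
From mathcomp Require Import ring lra.

Import Order.TTheory GRing.Theory Num.Theory.
Import numFieldNormedType.Exports.

Local Open Scope ring_scope.
Local Open Scope complex_scope.

Section StabilityPolynomial.
Variable R : realType.

(** Multiples of [splitC] and of [splitD] square to zero, so each exponential is the identity plus
    its exponent and the five-fold product is polynomial in [q]. *)
Lemma AstepE (a : R[i]) (q : R) :
  Astep a q = 1 - q%:C ^+ 2 / 2 + a * (1 - 2 * a) / 4 * q%:C ^+ 4.
Proof.
have C2 c e : (c *: (e *: delta_mx 1 0) : 'M[R[i]]_2) ^+ 2 = 0.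
  by rewrite expr2 -!(scalerAl, scalerAr) -mulmxE mul_delta_mx_0 ?scaler0.
have D2 c e : (c *: (e *: - delta_mx 0 1) : 'M[R[i]]_2) ^+ 2 = 0.
  rewrite expr2 !scalerN mulrNN -!(scalerAl, scalerAr) -mulmxE.
  by rewrite mul_delta_mx_0 ?scaler0.
have E2 (X Y : 'M[R[i]]_2) i j : (X * Y) i j = X i 0 * Y 0 j + X i 1 * Y 1 j.
  rewrite -mulmxE mxE big_ord_recl big_ord1.
  by congr (_ + _ * _); congr fun_of_matrix; exact/val_inj.
have prod (U V W : 'M[R[i]]_2) u v w : U = 1 + u *: delta_mx 1 0 ->
    V = 1 - v *: delta_mx 0 1 -> W = 1 + w *: delta_mx 1 0 ->
    (U * V * W * V * U) 0 0 =
      1 - 2 * u * v - v * w + u * v ^+ 2 * w.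
  move=> eU eV eW; rewrite !E2.
  have [-> -> ->] : [/\ U 0 0 = 1, U 0 1 = 0 & U 1 0 = u].
    by rewrite eU !mxE /=; split; ring.
  have [-> -> -> ->] : [/\ V 0 0 = 1, V 0 1 = - v, V 1 0 = 0 & V 1 1 = 1].
    by rewrite eV !mxE /=; split; ring.
  have [-> -> -> ->] : [/\ W 0 0 = 1, W 0 1 = 0, W 1 0 = w & W 1 1 = 1].
    by rewrite eW !mxE /=; split; ring.
  ring.
have expC c : expm (c *: splitC 1 q) = 1 + (c * q%:C) *: delta_mx 1 0.
  by rewrite /splitC expm_sqr0 // scalerA mul1r.
have expD c : expm (c *: splitD 1 q) = 1 - (c * q%:C) *: delta_mx 0 1.
  by rewrite /splitD expm_sqr0 // scalerA mul1r scalerN.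
rewrite /Astep /Mstep /one_step (prod _ _ _ _ _ _ (expC _) (expD _) (expC _)).
by rewrite rmorph1; field.
Qed.

(** The two coefficients are the roots of [12 a^2 - 6 a + 1]; this value makes the quartic
    coefficient [1/24], as in the Taylor series of the cosine. *)
Lemma a_pm_mul (a : R[i]) :
  a = a_plus R \/ a = a_minus R -> a * (1 - 2 * a) = 6^-1.
Proof.
(* With [a = 1/4 +- i t], the imaginary part of [a (1 - 2 a)] cancels and the real part is
   [1/8 + 2 t^2], so only [t^2] is needed. *)
have r3 : (4 * Num.sqrt 3 : R)^-1 ^+ 2 = 48^-1.
  by rewrite exprVn exprMn sqr_sqrtr ?ler0n //; congr (_^-1); ring.
have two : (2 : R[i]) = (2 : R)%:C by rewrite rmorph_nat.
have six : (6^-1 : R[i]) = (6^-1 : R)%:C by rewrite fmorphV rmorph_nat.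
case=> ->; rewrite two six /a_plus /a_minus; move: r3; set t := _^-1 => r3;
  simpc; congr (_ +i* _); nra.
Qed.

Lemma Astep_pm (a : R[i]) (q : R) : a = a_plus R \/ a = a_minus R ->
  Astep a q = (1 - q ^+ 2 / 2 + q ^+ 4 / 24)%:C.
Proof.
move=> ha; rewrite AstepE a_pm_mul // !(rmorphD, rmorphB, rmorphM, rmorphXn).
rewrite rmorph1 !fmorphV !rmorph_nat.
by field.
Qed.

Lemma norm_Astep_pm (a : R[i]) (q : R) : a = a_plus R \/ a = a_minus R ->
  `|Astep a q| = `|1 - q ^+ 2 / 2 + q ^+ 4 / 24|%:C.
Proof. by move=> ha; rewrite Astep_pm // normc_def /= expr0n addr0 sqrtr_sqr. Qed.

Lemma norm_Astep_pm_lt1 (a : R[i]) (q : R) : a = a_plus R \/ a = a_minus R ->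
  0 < q ^+ 2 < 12 -> `|Astep a q| < 1.
Proof.
move=> ha /andP[q0 q12].
rewrite norm_Astep_pm // -[1 in ltRHS](rmorph1 (real_complex R)) ltcR ltr_norml.
by rewrite (exprM q 2 2); apply/andP; split; nra.
Qed.

Lemma norm_Astep_pm_le1 (a : R[i]) (q : R) : a = a_plus R \/ a = a_minus R ->
  (`|Astep a q| <= 1) = (q ^+ 2 <= 12).
Proof.
move=> ha.
rewrite norm_Astep_pm // -[1 in leRHS](rmorph1 (real_complex R)) lecR ler_norml.
have := sqr_ge0 q; rewrite (exprM q 2 2); set x := q ^+ 2 => x0.
apply/andP/idP => [[_ h]|h]; last by split; nra.
by rewrite leNgt; apply/negP => x12; clear a ha; nra.
Qed.

Lemma stability_interval_pm (a : R[i]) (q : R) :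
  a = a_plus R \/ a = a_minus R -> stability_interval a q <-> q ^+ 2 <= 12.
Proof.
move=> ha; rewrite /stability_interval.
have -> : [set p : R | `|Astep a p| <= 1]%classic = [set p | p ^+ 2 <= 12]%classic.
  by apply/funext => p; rewrite /mkset norm_Astep_pm_le1.
rewrite connected_component_id //; first by rewrite /mkset expr0n ler0n.
clear a ha.
apply/connected_intervalP => x y; rewrite /mkset => hx hy z /andP[xz zy].
(* Squaring is monotone only on each half-line: a nonnegative [z] is compared with [y], a negative
   one with [x] after a change of sign. *)
have [z0|z0] := leP 0 z; first by
  apply: le_trans hy; rewrite ler_sqr ?nnegrE //; lra.
apply: le_trans hx; rewrite -[z ^+ 2]sqrrN -[x ^+ 2]sqrrN.
by rewrite ler_sqr ?nnegrE //; lra.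
Qed.

End StabilityPolynomial.

Section CflThreshold.
Variable R : realType.

Lemma sin3x (x : R) : sin (3 * x) = 3 * sin x - 4 * sin x ^+ 3.
Proof.
have h := canRL (addrK _) (cos2Dsin2 x).
have -> : 3 * x = x + x + x by ring.
rewrite sinD sinD cosD.
have -> : (sin x * cos x + cos x * sin x) * cos x +
  (cos x * cos x - sin x * sin x) * sin x =
  3 * sin x * cos x ^+ 2 - sin x ^+ 3 by ring.
by rewrite h; ring.
Qed.

Lemma etaE (dx k : R) : eta dx k =
  2 * sin (k * dx / 2) + sin (k * dx / 2) ^+ 3 / 3.
Proof.
rewrite /eta -!mulrA sin3x !mulrA.
by field.
Qed.

Lemma eta_sqr_le (dx k : R) : eta dx k ^+ 2 <= 49 / 9.
Proof.
rewrite etaE; set t := sin _.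
have t1 : t ^+ 2 <= 1 by have := cos2Dsin2 (k * dx / 2); rewrite -/t; nra.
(* In [x = t^2], which lies in [[0, 1]], the two factors are bounded separately, by [1] and
   [(7/3)^2]. *)
have -> : (2 * t + t ^+ 3 / 3) ^+ 2 = t ^+ 2 * (2 + t ^+ 2 / 3) ^+ 2 by field.
have := sqr_ge0 t; move: t1; set x := t ^+ 2 => x1 x0.
have : (2 + x / 3) ^+ 2 <= 49 / 9 by nra.
by move=> h; nra.
Qed.

Lemma eta_pi (dx : R) : 0 < dx -> eta dx (pi / dx) = 7 / 3.
Proof.
by move=> dx0; rewrite etaE divfK ?gt_eqF // sin_pihalf; field.
Qed.

Lemma qmode_sqr (d : nat) (nu dx dt : R) (kappa : 'rV[R]_d) :
  qmode nu dx dt kappa ^+ 2 =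
  courant nu dx dt ^+ 2 * \sum_(xi < d) eta dx (kappa 0 xi) ^+ 2.
Proof.
rewrite /qmode /Kh /courant !exprMn sqr_sqrtr ?exprVn ?mulrA//.
by rewrite mulr_ge0 ?invr_ge0 ?sqr_ge0 // sumr_ge0 // => i _; exact: sqr_ge0.
Qed.

(** For [d = 0] the convention [0^-1 = 0] would make the value [0]. *)
Lemma s_disp_gt0 (d : nat) : (1 <= d)%N -> 0 < s_disp R d.
Proof. by move=> d1; rewrite divr_gt0 // mulr_gt0 // sqrtr_gt0 ltr0n. Qed.

Lemma s_disp_sqr (d : nat) : s_disp R d ^+ 2 = 108 / (49 * d%:R).
Proof.
rewrite /s_disp exprMn exprVn !exprMn !sqr_sqrtr ?ler0n //.
by congr (_ / (_ * _)); ring.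
Qed.

Lemma spectrally_stable_pm (a : R[i]) (d : nat) (nu dx dt : R) :
  a = a_plus R \/ a = a_minus R -> (1 <= d)%N -> 0 < nu -> 0 < dx -> 0 < dt ->
  spectrally_stable a d nu dx dt <-> courant nu dx dt <= s_disp R d.
Proof.
move=> ha d1 nu0 dx0 dt0.
have s0 : 0 <= courant nu dx dt by rewrite !(mulr_ge0, invr_ge0) // ltW.
have d0 : 0 < d%:R :> R by rewrite ltr0n.
(* Both sides are nonnegative, so their squares are compared; the goal becomes [s^2 * 49 d <= 108],
   nine times the bound [q^2 <= 12] at the extremal mode. *)
rewrite -ler_sqr ?nnegrE ?(ltW (s_disp_gt0 _ d1)) // s_disp_sqr.
rewrite ler_pdivlMr; last by rewrite mulr_gt0.
split=> [st|le_s kappa].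
- have /(stability_interval_pm _ _ _ ha) := st (const_mx (pi / dx)).
  rewrite qmode_sqr (eq_bigr (fun=> (7 / 3) ^+ 2)) => [|i _]; last first.
    by rewrite mxE eta_pi.
  rewrite sumr_const card_ord -mulr_natr; set s2 := _ ^+ 2 => h.
  have -> : s2 * (49 * d%:R) = 9 * (s2 * ((7 / 3) ^+ 2 * d%:R)) by field.
  by lra.
- apply/stability_interval_pm => //; rewrite qmode_sqr.
  have : \sum_(xi < d) eta dx (kappa 0 xi) ^+ 2 <= 49 / 9 * d%:R.
    rewrite mulr_natr -[leRHS](_ : \sum_(xi < d) (49 / 9) = _).
      by apply: ler_sum => i _; exact: eta_sqr_le.
    by rewrite sumr_const card_ord.
  move=> /(ler_wpM2l (sqr_ge0 (courant nu dx dt))) /le_trans; apply.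
  by move: le_s; set s2 := _ ^+ 2 => le_s; lra.
Qed.

(** The supremum is attained: stability includes the endpoint [q^2 = 12], so the time step with
    Courant number exactly [s_disp] is admissible. *)
Lemma cfl_threshold_pm (a : R[i]) (d : nat) (nu dx : R) :
  a = a_plus R \/ a = a_minus R -> (1 <= d)%N -> 0 < nu -> 0 < dx ->
  cfl_threshold a d nu dx = (s_disp R d)%:E.
Proof.
move=> ha d1 nu0 dx0; apply/le_anti/andP; split.
- apply: ge_ereal_sup => _ [dt [dt0 st] <-].
  by rewrite lee_fin -(spectrally_stable_pm a).
- have dt0 : 0 < s_disp R d * dx / nu.
    exact: divr_gt0 (mulr_gt0 (s_disp_gt0 _ d1) dx0) nu0.
  have sE : courant nu dx (s_disp R d * dx / nu) = s_disp R d.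
    by rewrite /courant [nu * _]mulrC divfK ?mulfK ?gt_eqF.
  apply: ereal_sup_ubound; exists (s_disp R d * dx / nu); last by rewrite sE.
  by split=> //; apply/spectrally_stable_pm => //; rewrite sE.
Qed.

End CflThreshold.

Theorem proposition3p4 (R : realType) (a : R[i])
    (ha : a = a_plus R \/ a = a_minus R) :
  (forall q : R, Astep a q \is Num.real /\
     Astep a q = (1 - q ^+ 2 / 2 + q ^+ 4 / 24)%:C) /\
  (forall q : R, 0 < q ^+ 2 < 12 -> `|Astep a q| < 1) /\
  (forall (d : nat) (nu dx : R), (1 <= d)%N -> 0 < nu -> 0 < dx ->
     cfl_threshold a d nu dx = (s_disp R d)%:E /\
     (forall dt : R, 0 < dt ->
        (robust_step a d nu dx dt <-> courant nu dx dt < s_disp R d))).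
Proof.
split=> [q|].
  rewrite Astep_pm //; split=> //.
  (* Being real in [R[i]] means being comparable with [0], which for an embedded real number reduces
     to the total order of [R]. *)
  by rewrite realE -(rmorph0 (real_complex R)) !lecR -realE num_real.
split=> [q|d nu dx d1 nu0 dx0]; first exact: norm_Astep_pm_lt1.
by rewrite /robust_step cfl_threshold_pm.
Qed.
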